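(* Let $\xi=(-1)^{1/4}=e^{2\pi i/8}$ and change variables of $\mathbb C^8$ by $$\begin{aligned}u_0&=x_0+\xi x_2-x_4+\xi x_6,& u_1&=x_1+\xi x_3-x_5+\xi x_7,\\ u_2&=\xi x_0+x_2+\xi x_4-x_6,& u_3&=\xi x_1+x_3+\xi x_5-x_7,\\ u_4&=-x_0+\xi x_2+x_4+\xi x_6,& u_5&=-x_1+\xi x_3+x_5+\xi x_7,\\ u_6&=\xi x_0-x_2+\xi x_4+x_6,& u_7&=\xi x_1-x_3+\xi x_5+x_7.\end{aligned}$$ Then the four generators of the ideal $I_C=\langle \frac i2(x_0^2+x_4^2)+x_2x_6,\ \frac i2(x_1^2+x_5^2)+x_3x_7,\ \frac i2(x_2^2+x_6^2)+x_0x_4,\ \frac i2(x_3^2+x_7^2)+x_1x_5\rangle$ are expressed by $$\begin{aligned}\tfrac i2(x_0^2+x_4^2)+x_2x_6&=\tfrac14(u_2u_6-i\,u_0u_4),& \tfrac i2(x_1^2+x_5^2)+x_3x_7&=\tfrac14(u_3u_7-i\,u_1u_5),\\ \tfrac i2(x_2^2+x_6^2)+x_0x_4&=\tfrac14(u_0u_4-i\,u_2u_6),& \tfrac i2(x_3^2+x_7^2)+x_1x_5&=\tfrac14(u_1u_5-i\,u_3u_7).\end{aligned}$$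
   Context: $x_0,\dots,x_7$ are coordinates on $\mathbb C^8$ (homogeneous coordinates of $\mathbb P^7$) and $i=\sqrt{-1}=\xi^2$. The ideal $I_C$ is generated by the values at $w=(i,0,1)$ of the quadrics $f_1=\frac{w_0}{2}(x_0^2+x_4^2)+w_1(x_1x_7+x_3x_5)+w_2x_2x_6$, $f_2=\frac{w_0}{2}(x_1^2+x_5^2)+w_1(x_2x_0+x_4x_6)+w_2x_3x_7$, $f_3=\frac{w_0}{2}(x_2^2+x_6^2)+w_1(x_3x_1+x_5x_7)+w_2x_4x_0$, $f_4=\frac{w_0}{2}(x_3^2+x_7^2)+w_1(x_4x_2+x_6x_0)+w_2x_5x_1$. *)

(* Defs.v *)
From mathcomp Require Import all_boot all_order all_algebra.
From mathcomp Require Import reals.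
From mathcomp Require Import complex mpoly.
(* Not imported: the notations of mathcomp-analysis clash with those of mpoly. *)
From mathcomp Require sequences exp trigo.

Set Implicit Arguments.
Unset Strict Implicit.
Unset Printing Implicit Defensive.

Import Order.TTheory GRing.Theory Num.Theory.
Local Open Scope ring_scope.
Local Open Scope complex_scope.

(* R[i] is the field of complex numbers over R, and 'i%C its element 0 +i* 1. *)

(* e^(a + i b) = e^a (cos b + i sin b). *)
Definition cexp (R : realType) (z : R[i]) : R[i] :=
  (sequences.expR (complex.Re z))%:C *
    (trigo.cos (complex.Im z) +i* trigo.sin (complex.Im z)).

Definition xi (R : realType) : R[i] :=
  cexp (2 * (trigo.pi : R)%:C * 'i%C / 8).

Lemma xiE (R : realType) :
  xi R = trigo.cos ((trigo.pi : R) / 4) +i* trigo.sin ((trigo.pi : R) / 4).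
Proof.
have -> : xi R = cexp (0 +i* ((trigo.pi : R) / 4)).
  rewrite /xi; congr cexp.
  have n8 : (8 : R[i]) != 0 by rewrite pnatr_eq0.
  apply: (mulIf n8); rewrite divfK //.
  have -> : (8 : R[i]) = 8%:R%:C by rewrite rmorph_nat.
  have -> : (2 : R[i]) = 2%:R%:C by rewrite rmorph_nat.
  apply/eqP; rewrite eq_complex /=.
  rewrite !(mulr0, mul0r, mulr1, addr0, subr0, add0r, subrr) eqxx /=.
  have -> : (8%:R : R) = 4 * 2 by rewrite -natrM.
  by rewrite mulrA divfK ?pnatr_eq0 // mulrC.
by rewrite /cexp /= exp.expR0 mul1r.
Qed.

Lemma xi_sqr (R : realType) : xi R ^+ 2 = 'i%C.
Proof.
have pi2 : (trigo.pi : R) / 4 *+ 2 = (trigo.pi : R) / 2.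
  have n2 : (2 : R) != 0 by rewrite pnatr_eq0.
  have -> : (4 : R) = 2 * 2 by rewrite -natrM.
  by rewrite invfM mulrA -mulr_natr divfK.
rewrite xiE expr2; apply/eqP; rewrite eq_complex /=; apply/andP; split; apply/eqP.
  by rewrite -trigo.cosD -mulr2n pi2 trigo.cos_pihalf.
by rewrite addrC -trigo.sinD -mulr2n pi2 trigo.sin_pihalf.
Qed.

Lemma xi_fourth (R : realType) : xi R ^+ 4 = -1.
Proof.
rewrite (exprM (xi R) 2 2) xi_sqr expr2.
by apply/eqP; rewrite eq_complex /= !(mulr0, mul0r, mulr1, sub0r, addr0, oppr0) !eqxx.
Qed.

(* Only meant for k < 8: [inord] returns a default index beyond that. *)
Definition xvar (R : realType) (k : nat) : {mpoly R[i][8]} := 'X_(inord k).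
Arguments xvar R k%_N.

Section Quadrics.
Variables (R : realType) (w0 w1 w2 : R[i]).
Local Notation x0 := (xvar R 0).
Local Notation x1 := (xvar R 1).
Local Notation x2 := (xvar R 2).
Local Notation x3 := (xvar R 3).
Local Notation x4 := (xvar R 4).
Local Notation x5 := (xvar R 5).
Local Notation x6 := (xvar R 6).
Local Notation x7 := (xvar R 7).

Definition f1 : {mpoly R[i][8]} :=
  (w0 / 2) *: (x0 ^+ 2 + x4 ^+ 2) + w1 *: (x1 * x7 + x3 * x5)
    + w2 *: (x2 * x6).

Definition f2 : {mpoly R[i][8]} :=
  (w0 / 2) *: (x1 ^+ 2 + x5 ^+ 2) + w1 *: (x2 * x0 + x4 * x6)
    + w2 *: (x3 * x7).

Definition f3 : {mpoly R[i][8]} :=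
  (w0 / 2) *: (x2 ^+ 2 + x6 ^+ 2) + w1 *: (x3 * x1 + x5 * x7)
    + w2 *: (x4 * x0).

Definition f4 : {mpoly R[i][8]} :=
  (w0 / 2) *: (x3 ^+ 2 + x7 ^+ 2) + w1 *: (x4 * x2 + x6 * x0)
    + w2 *: (x5 * x1).

End Quadrics.

Definition ideal_gen (A : comNzRingType) (n : nat) (g : n.-tuple A) (p : A) : Prop :=
  exists a : 'I_n -> A, p = \sum_(k < n) a k * tnth g k.

Definition I_C (R : realType) : {mpoly R[i][8]} -> Prop :=
  ideal_gen [tuple f1 'i%C 0 1; f2 'i%C 0 1; f3 'i%C 0 1; f4 'i%C 0 1].

(* n linear forms that are coordinates on K^n: the point v is determined by,
   and can be recovered from, arbitrary values of the forms at v. *)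
Definition linear_coordinates (K : fieldType) (n : nat)
    (u : n.-tuple {mpoly K[n]}) : Prop :=
  (forall k : 'I_n, tnth u k \is 1.-homog) /\
  bijective (fun v : 'rV[K]_n => \row_(k < n) (tnth u k).@[v 0]).

(* Main.v *)
Require Import Defs.
From mathcomp Require Import all_boot all_order all_algebra.
From mathcomp Require Import reals.
From mathcomp Require Import complex mpoly.
From mathcomp Require Import ring.

Import GRing.Theory Num.Theory.
Local Open Scope ring_scope.

(** Both the change of variables and the four identities split into two copies
    of one computation, for the variables with even indices and for those with
    odd indices.  In the even copy the four forms pair up as
    [xi (x2 + x6) +- (x0 - x4)], which are [u0] and [u4], and
    [xi (x0 + x4) +- (x2 - x6)], which are [u2] and [u6].

    Hence, as [xi ^+ 2 = i], the products [u0 u4] and [u2 u6] are differences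
    of squares, [i (x2 + x6)^2 - (x0 - x4)^2] and
    [i (x0 + x4)^2 - (x2 - x6)^2].  In [u2 u6 - i u0 u4] the squares of sum and
    difference of [x0] and [x4] carry the same coefficient [i], so that their
    cross terms cancel, while those of [x2] and [x6] carry opposite
    coefficients, so that only the cross term survives; this is
    [2 i (x0^2 + x4^2) + 4 x2 x6].  The roles are exchanged in
    [u0 u4 - i u2 u6].  Exchanging
    [(x0, x4)] with [(x2, x6)] exchanges [(u0, u4)] with [(u2, u6)], so the
    second identity ([pencil_quadric_factored_dual]) follows from the first
    ([pencil_quadric_factored]).

    The sums and differences within the pairs give back [x0 +- x4] and
    [x2 +- x6], because [2] and [xi] are invertible; this is the inverse of the
    change of variables ([block_formsK], [block_coordsK]). *)

(** * The quadrics as combinations of products of linear forms *)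

(** With [(a, c) = (x0, x4)] and [(b, d) = (x2, x6)] this is the identity for
    the first generator; the odd-indexed variables give the second. *)
Lemma pencil_quadric_factored (K : numFieldType) (A : comAlgType K)
    (s j : K) (a b c d : A) :
  s ^+ 2 = j -> j ^+ 2 = -1 ->
  (j / 2) *: (a ^+ 2 + c ^+ 2) + b * d =
  4^-1 *: ((s *: a + b + s *: c - d) * (s *: a - b + s *: c + d)
           - j *: ((a + s *: b - c + s *: d) * (- a + s *: b + c + s *: d))).
Proof.
move=> s2 j2.
have n4 : (4 : K) != 0 by rewrite pnatr_eq0.
apply: (scalerI n4); rewrite scalerA mulfV // scale1r scalerDr scalerA.
have -> : 4 * (j / 2) = 2 * j by field.
have -> : (4 : K) *: (b * d) = 4 * (b * d) by rewrite !scaler_nat mulr_natl.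
(* Scaling by [s], [j] becomes multiplication by their images in [A], so that
   the rest is a commutative ring identity. *)
rewrite -(mulr_algl s a) -(mulr_algl s b) -(mulr_algl s c) -(mulr_algl s d).
rewrite -scalerA scaler_nat -(mulr_algl j (a ^+ 2 + _)) -(mulr_algl j (_ * _)).
set S := s *: 1; set J := j *: 1.
have SS : S * S = J by rewrite -scalerAl mul1r scalerA -expr2 s2.
have JJ : J * J = -1 by rewrite -scalerAl mul1r scalerA -expr2 j2 scaleN1r.
have -> : (S * a + b + S * c - d) * (S * a - b + S * c + d)
          = S * S * (a + c) ^+ 2 - (b - d) ^+ 2 by ring.
have -> : (a + S * b - c + S * d) * (- a + S * b + c + S * d)
          = S * S * (b + d) ^+ 2 - (a - c) ^+ 2 by ring.
rewrite SS [J * (J * _ - _)]mulrBr [J * (J * _)]mulrA JJ; ring.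
Qed.

Lemma pencil_quadric_factored_dual (K : numFieldType) (A : comAlgType K)
    (s j : K) (a b c d : A) :
  s ^+ 2 = j -> j ^+ 2 = -1 ->
  (j / 2) *: (b ^+ 2 + d ^+ 2) + a * c =
  4^-1 *: ((a + s *: b - c + s *: d) * (- a + s *: b + c + s *: d)
           - j *: ((s *: a + b + s *: c - d) * (s *: a - b + s *: c + d))).
Proof.
move=> s2 j2; rewrite (pencil_quadric_factored _ _ s j b a d c) //.
by congr (_ *: (_ * _ - _ *: (_ * _))); ring.
Qed.

(** * Inverting the change of variables *)

(** The values of [u0], [u2], [u4], [u6] when [x0], [x2], [x4], [x6] take the
    values [a], [b], [c], [d]. *)
Definition block_forms {K : fieldType} (s a b c d : K) : K * K * K * K :=
  (a + s * b - c + s * d, s * a + b + s * c - d,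
   - a + s * b + c + s * d, s * a - b + s * c + d).

(** Obtained from [p + r = 2 s (b + d)], [p - r = 2 (a - c)],
    [q + t = 2 s (a + c)], [q - t = 2 (b - d)]. *)
Definition block_coords {K : fieldType} (s p q r t : K) : K * K * K * K :=
  (((q + t) / s + (p - r)) / 4, ((p + r) / s + (q - t)) / 4,
   ((q + t) / s - (p - r)) / 4, ((p + r) / s - (q - t)) / 4).

Lemma block_formsK (K : numFieldType) (s a b c d : K) : s != 0 ->
  let: (p, q, r, t) := block_forms s a b c d in
  block_coords s p q r t = (a, b, c, d).
Proof. by move=> s0; rewrite /block_coords; congr (_, _, _, _); field. Qed.

Lemma block_coordsK (K : numFieldType) (s p q r t : K) : s != 0 ->
  let: (a, b, c, d) := block_coords s p q r t in
  block_forms s a b c d = (p, q, r, t).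
Proof. by move=> s0; rewrite /block_forms; congr (_, _, _, _); field. Qed.

Definition interleave {K : fieldType} (e o : K * K * K * K) : 'rV[K]_8 :=
  let: (e0, e1, e2, e3) := e in
  let: (o0, o1, o2, o3) := o in
  \row_(k < 8) tnth [tuple e0; o0; e1; o1; e2; o2; e3; o3] k.

Definition block_map {K : fieldType} (f : K -> K -> K -> K -> K * K * K * K)
    (v : 'rV[K]_8) : 'rV[K]_8 :=
  let y k := v 0 (inord k) in
  interleave (f (y 0%N) (y 2%N) (y 4%N) (y 6%N))
             (f (y 1%N) (y 3%N) (y 5%N) (y 7%N)).

Lemma interleave_inord (K : fieldType) (v : 'rV[K]_8) :
  let y k := v 0 (inord k) in
  interleave (y 0%N, y 2%N, y 4%N, y 6%N) (y 1%N, y 3%N, y 5%N, y 7%N) = v.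
Proof.
apply/rowP => k; rewrite !mxE.
by case: k => [[|[|[|[|[|[|[|[|]]]]]]]] lk] //; rewrite (tnth_nth 0) /=;
  congr (v 0 _); apply: val_inj; rewrite /= inordK.
Qed.

Lemma block_mapK (K : fieldType) (f g : K -> K -> K -> K -> K * K * K * K) :
  (forall a b c d, let: (p, q, r, t) := f a b c d in g p q r t = (a, b, c, d)) ->
  cancel (block_map f) (block_map g).
Proof.
move=> fK v; rewrite -[RHS]interleave_inord /block_map.
set y := fun k => v 0 (inord k).
have := fK (y 0%N) (y 2%N) (y 4%N) (y 6%N).
case: (f _ _ _ _) => [[[p q] r] t] ge.
have := fK (y 1%N) (y 3%N) (y 5%N) (y 7%N).
case: (f _ _ _ _) => [[[p' q'] r'] t'] go.
by rewrite -ge -go /interleave !mxE !(tnth_nth 0) !inordK.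
Qed.

Lemma xvar_homog (R : realType) (k : nat) : xvar R k \is 1.-homog.
Proof. by rewrite dhomogX /= mdeg1. Qed.

Lemma block_forms_homog (K : fieldType) (n : nat) (s : K)
    (a b c d : {mpoly K[n]}) (m : nat) :
  a \is m.-homog -> b \is m.-homog -> c \is m.-homog -> d \is m.-homog ->
  [/\ a + s *: b - c + s *: d \is m.-homog,
      s *: a + b + s *: c - d \is m.-homog,
      - a + s *: b + c + s *: d \is m.-homog &
      s *: a - b + s *: c + d \is m.-homog].
Proof.
move=> ha hb hc hd.
by split; do !(apply: rpredD || apply: rpredB || apply: rpredZ
               || (rewrite rpredN)).
Qed.

Lemma block_forms_meval (K : fieldType) (n : nat) (s : K)
    (a b c d : {mpoly K[n]}) (v : 'I_n -> K) :
  ((a + s *: b - c + s *: d).@[v], (s *: a + b + s *: c - d).@[v],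
   (- a + s *: b + c + s *: d).@[v], (s *: a - b + s *: c + d).@[v])
  = block_forms s a.@[v] b.@[v] c.@[v] d.@[v].
Proof. by rewrite !(mevalD, mevalB, mevalN, mevalZ). Qed.

(** The linear forms are variables here, known only by their degree and by
    their values, so that the blocks can be reordered without unfolding them. *)
Lemma linear_coordinates_of_blocks (K : numFieldType) (s : K)
    (u0 u1 u2 u3 u4 u5 u6 u7 : {mpoly K[8]}) :
  s != 0 ->
  [/\ u0 \is 1.-homog, u2 \is 1.-homog, u4 \is 1.-homog & u6 \is 1.-homog] ->
  [/\ u1 \is 1.-homog, u3 \is 1.-homog, u5 \is 1.-homog & u7 \is 1.-homog] ->
  (forall v : 'I_8 -> K, (u0.@[v], u2.@[v], u4.@[v], u6.@[v]) =
     block_forms s (v (inord 0)) (v (inord 2)) (v (inord 4)) (v (inord 6))) ->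
  (forall v : 'I_8 -> K, (u1.@[v], u3.@[v], u5.@[v], u7.@[v]) =
     block_forms s (v (inord 1)) (v (inord 3)) (v (inord 5)) (v (inord 7))) ->
  linear_coordinates [tuple u0; u1; u2; u3; u4; u5; u6; u7].
Proof.
move=> s0 [h0 h2 h4 h6] [h1 h3 h5 h7] even_values odd_values; split.
  by case=> [[|[|[|[|[|[|[|[|]]]]]]]] lk] //; rewrite (tnth_nth 0).
apply: (@eq_bij _ _ (block_map (block_forms s))).
  by exists (block_map (block_coords s)); apply: block_mapK => *;
    [apply: block_formsK | apply: block_coordsK].
move=> v; rewrite /block_map -even_values -odd_values.
apply/rowP => k; rewrite !mxE.
by case: k => [[|[|[|[|[|[|[|[|]]]]]]]] lk] //; rewrite !(tnth_nth 0).
Qed.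

Theorem proposition8p8 (R : realType) :
  let i : R[i] := 'i%C in
  let xi : R[i] := xi R in
  let x0 := xvar R 0 in
  let x1 := xvar R 1 in
  let x2 := xvar R 2 in
  let x3 := xvar R 3 in
  let x4 := xvar R 4 in
  let x5 := xvar R 5 in
  let x6 := xvar R 6 in
  let x7 := xvar R 7 in
  let u0 : {mpoly R[i][8]} := x0 + xi *: x2 - x4 + xi *: x6 in
  let u1 : {mpoly R[i][8]} := x1 + xi *: x3 - x5 + xi *: x7 in
  let u2 : {mpoly R[i][8]} := xi *: x0 + x2 + xi *: x4 - x6 in
  let u3 : {mpoly R[i][8]} := xi *: x1 + x3 + xi *: x5 - x7 in
  let u4 : {mpoly R[i][8]} := - x0 + xi *: x2 + x4 + xi *: x6 in
  let u5 : {mpoly R[i][8]} := - x1 + xi *: x3 + x5 + xi *: x7 in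
  let u6 : {mpoly R[i][8]} := xi *: x0 - x2 + xi *: x4 + x6 in
  let u7 : {mpoly R[i][8]} := xi *: x1 - x3 + xi *: x5 + x7 in
  let q1 : {mpoly R[i][8]} := (i / 2) *: (x0 ^+ 2 + x4 ^+ 2) + x2 * x6 in
  let q2 : {mpoly R[i][8]} := (i / 2) *: (x1 ^+ 2 + x5 ^+ 2) + x3 * x7 in
  let q3 : {mpoly R[i][8]} := (i / 2) *: (x2 ^+ 2 + x6 ^+ 2) + x0 * x4 in
  let q4 : {mpoly R[i][8]} := (i / 2) *: (x3 ^+ 2 + x7 ^+ 2) + x1 * x5 in
  [/\ linear_coordinates [tuple u0; u1; u2; u3; u4; u5; u6; u7],
      [/\ f1 i 0 1 = q1, f2 i 0 1 = q2, f3 i 0 1 = q3 & f4 i 0 1 = q4],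
      (forall p : {mpoly R[i][8]},
         I_C p <-> ideal_gen [tuple q1; q2; q3; q4] p) &
      [/\ q1 = 4^-1 *: (u2 * u6 - i *: (u0 * u4)),
          q2 = 4^-1 *: (u3 * u7 - i *: (u1 * u5)),
          q3 = 4^-1 *: (u0 * u4 - i *: (u2 * u6)) &
          q4 = 4^-1 *: (u1 * u5 - i *: (u3 * u7))]].
Proof.
move=> i xi x0 x1 x2 x3 x4 x5 x6 x7 u0 u1 u2 u3 u4 u5 u6 u7 q1 q2 q3 q4.
have xi2 : xi ^+ 2 = i by exact: xi_sqr.
have i2 : i ^+ 2 = -1 by rewrite -xi2 -exprM xi_fourth.
have xi_neq0 : xi != 0.
  apply/eqP => xi0; have := xi_fourth R; rewrite -/xi xi0 expr0n => /eqP.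
  by rewrite eq_sym oppr_eq0 oner_eq0.
have [E1 E2 E3 E4] :
    [/\ f1 i 0 1 = q1, f2 i 0 1 = q2, f3 i 0 1 = q3 & f4 i 0 1 = q4].
  have middle_term_vanishes w (p q r : {mpoly R[i][8]}) :
      w *: p + 0 *: q + 1 *: r = w *: p + r.
    by rewrite scale0r scale1r addr0.
  split; rewrite [LHS]middle_term_vanishes //; congr (_ + _); exact: mulrC.
split.
- have hx k := xvar_homog R k.
  apply: (linear_coordinates_of_blocks _ xi) => //.
  + by apply: block_forms_homog; exact: hx.
  + by apply: block_forms_homog; exact: hx.
  + by move=> v; rewrite block_forms_meval !mevalXU.
  + by move=> v; rewrite block_forms_meval !mevalXU.
- by split.
- by move=> p; rewrite /I_C -/i E1 E2 E3 E4.
- split; rewrite /q1 /q2 /q3 /q4.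
  + exact: pencil_quadric_factored.
  + exact: pencil_quadric_factored.
  + exact: pencil_quadric_factored_dual.
  + exact: pencil_quadric_factored_dual.
Qed.
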